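(* Suppose that $2k$ lines in the projective plane meet another line in $k$ triple points. Color the lines so that the line containing all the triple points is green and each of the $k$ collinear triple points has a red and a blue line passing through it. Then there is a unique curve of degree $k-1$ passing through the points where the red lines meet the blue lines off the green line.
   Context: Here $k\ge 1$ is an integer, and the projective plane is the complex projective plane $\mathbb{P}^2$. The $2k+1$ lines are distinct. A triple point is a point lying on exactly three of the lines, here the green line, one red line and one blue line; so there are $k$ red lines and $k$ blue lines. A form of degree $d$ is a homogeneous polynomial of degree $d$ in $\mathbb{C}[x,y,z]$. A curve of degree $d$ in $\mathbb{P}^2$ is given by the vanishing of a nonzero form of degree $d$, with forms identified when they are nonzero scalar multiples of one another; curves may be reducible. Uniqueness of the curve means uniqueness of its defining form up to a nonzero scalar.
   Formalization: Points where red lines meet blue lines off the green line are counted with multiplicity (via the local ideal of the products of the red and of the blue lines); uniqueness for plain passage through the points is proved only when exactly one red and one blue line pass through each of them. *)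

(* Defs.v *)
From mathcomp Require Import all_boot all_order all_algebra.
From mathcomp Require Import mpoly complex reals.

Set Implicit Arguments.
Unset Strict Implicit.
Unset Printing Implicit Defensive.

Import GRing.Theory.
Local Open Scope ring_scope.

(* Points of the complex projective plane are given by nonzero homogeneous
   coordinate vectors, and curves by nonzero forms; in both cases objects are
   identified when they are nonzero scalar multiples of one another. *)

Section ProjectivePlane.
Variable R : realType.
Implicit Types (P Q : 'rV[R[i]]_3) (F G A B : {mpoly (R[i])[3]}).

Definition value F P : R[i] := F.@[fun i => P 0 i].

Definition lies_on P F : bool := value F P == 0.

Definition same_point P Q : Prop := exists2 c : R[i], c != 0 & Q = c *: P.

Definition plane_curve (d : nat) F : Prop := F \is d.-homog /\ F != 0.

Definition same_curve F G : Prop := exists2 c : R[i], c != 0 & G = c *: F.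

Definition unique_curve (d : nat) (through : {mpoly (R[i])[3]} -> Prop) : Prop :=
  exists F, [/\ plane_curve d F, through F &
    forall G, plane_curve d G -> through G -> same_curve F G].

(* [F] lies in the ideal generated by [A] and [B] in the local ring of the
   plane at [P]: denominators are the polynomials not vanishing at [P]. *)
Definition in_local_ideal P A B F : Prop :=
  exists H U V : {mpoly (R[i])[3]}, ~~ lies_on P H /\ H * F = U * A + V * B.

Section ColoredLines.
Variables (k : nat) (g : {mpoly (R[i])[3]}).
Variables (L : 'I_(2 * k) -> {mpoly (R[i])[3]}) (red : {set 'I_(2 * k)}).

Definition lines_through P : {set 'I_(2 * k)} := [set i | lies_on P (L i)].

(* [g] is the green line, and the lines [L i] with [i \notin red] are blue.
   Together with [g], exactly three lines pass through a triple point. *)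
Record triple_point_configuration (p : 'I_k -> 'rV[R[i]]_3) : Prop := {
  green_line : plane_curve 1 g;
  other_lines : forall i, plane_curve 1 (L i);
  lines_distinct : forall i j, same_curve (L i) (L j) -> i = j;
  green_distinct : forall i, ~ same_curve g (L i);
  points_nonzero : forall t, p t != 0;
  points_distinct : forall s t, same_point (p s) (p t) -> s = t;
  points_green : forall t, lies_on (p t) g;
  points_triple : forall t, #|lines_through (p t)| = 2%N;
  points_red : forall t, exists2 i, i \in red & i \in lines_through (p t);
  points_blue : forall t, exists2 j, j \notin red & j \in lines_through (p t)
}.

(* The red line [L i] meets the blue line [L j] at [P], off the green line. *)
Definition crossing P (i j : 'I_(2 * k)) : Prop :=
  [/\ P != 0, ~~ lies_on P g, i \in red, j \notin red &
      lies_on P (L i) /\ lies_on P (L j)].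

Definition distinct_crossings : Prop :=
  forall P i j i' j', crossing P i j -> crossing P i' j' -> i = i' /\ j = j'.

Definition through_crossings F : Prop :=
  forall P i j, crossing P i j -> lies_on P F.

(* Crossings counted with multiplicity: [F] vanishes on the part off the green
   line of the scheme-theoretic intersection of the union of the red lines
   with the union of the blue lines. If several red or blue lines meet at a
   crossing, then vanishing at the points alone need not determine [F]: with
   the line at infinity green, take y = 0, x = 1, y = 2x - 1 red and y = 1,
   x = 0, y = 2x blue, whose crossings are only four points, lying on a pencil
   of conics. *)
Definition through_crossings_mult F : Prop :=
  forall P i j, crossing P i j ->
    in_local_ideal P (\prod_(a in red) L a) (\prod_(b in ~: red) L b) F.

Lemma through_crossings_multW F :
  through_crossings_mult F -> through_crossings F.
Proof.
move=> hF P i j hP; have [_ _ ri bj [Pi Pj]] := hP.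
have [H [U [V [nzH eqF]]]] := hF P i j hP.
move: Pi Pj nzH; rewrite /lies_on /value => /eqP Pi /eqP Pj nzH.
have := congr1 (meval (fun a => P 0 a)) eqF.
rewrite (bigD1 i) //= [\prod_(b in ~: red) _](bigD1 j) ?inE //= !(rmorphD, rmorphM) /= Pi Pj.
rewrite !mul0r !mulr0 addr0 => /eqP.
by rewrite mulf_eq0 (negPf nzH).
Qed.

End ColoredLines.
End ProjectivePlane.

(* Main.v *)
Require Import Defs.
From mathcomp Require Import all_boot all_order all_algebra.
From mathcomp Require Import mpoly complex reals ring.

(** Let [A] and [B] be the products of the [k] red and of the [k] blue lines.

    Existence. At each triple point the red line is a combination of the blue
    line and the green line [g], so [A] and [B] are proportional on the green line:
    some [A - c B] with [c] nonzero vanishes there and equals [g F] with [F] of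
    degree [k - 1] ([green_pencil]). Off the green line [g] is invertible, hence
    [F] lies in the ideal of [A] and [B] at every crossing ([green_combination]).

    Uniqueness. Rather than invoking Max Noether's theorem, restrict a form [G]
    that satisfies the conditions to a red line [l], with the point of [l] on the
    green line sent to infinity. There [A] vanishes, so the conditions say that
    the restriction of [B] divides that of [G] ([line_restr_local_dvd]). The
    restriction of [B] has degree exactly [k - 1]: one of the [k] blue lines passes
    through the point at infinity. For [G] of degree [k - 1] this leaves one free
    scalar, so a suitable combination [G - c F] vanishes on [l] and is a multiple
    [l G1]. Cancelling [l] in the local conditions, [G1] satisfies them for
    the remaining red lines ([in_local_ideal_peel]). Its degree is now less than
    [k - 1], so it vanishes on each of these lines in turn, and since they
    outnumber its degree it is zero ([low_degree_vanishes]).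

    When each crossing lies on one red and one blue line only, the local
    ideal at a crossing is the maximal ideal, and passing through the crossings
    is the same as satisfying the conditions with multiplicity
    ([distinct_through_mult]). *)

Local Open Scope ring_scope.

Set Implicit Arguments.
Unset Strict Implicit.
Unset Printing Implicit Defensive.

Import GRing.Theory Num.Theory.

(** * Vanishing, divisibility and substitution of polynomials *)

Lemma poly_vanish (F : numDomainType) (p : {poly F}) :
  (forall x, p.[x] = 0) -> p = 0.
Proof.
move=> p0; apply/eqP; apply: contraT => nz.
have := @max_poly_roots _ p [seq i%:R | i <- iota 0 (size p)] nz.
rewrite size_map size_iota ltnn map_inj_uniq ?iota_uniq.
  by move=> -> //; apply/allP => x _; rewrite rootE p0.
by move=> i j /eqP; rewrite eqr_nat => /eqP.
Qed.

Lemma multinom_eq_rcons n (m' : 'X_{1..n.+1}) (m : 'X_{1..n}) j :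
  (m' == [multinom of rcons m j]) =
  ([multinom m' (widen_ord (leqnSn n) i) | i < n] == m) && (j == m' ord_max).
Proof.
apply/eqP/andP => [-> | [/eqP <- /eqP ->]].
  split; apply/eqP.
    apply/mnmP => i; rewrite mnmE multinomE (tnth_nth 0%N) nth_rcons.
    by rewrite size_tuple /= ltn_ord (mnm_nth 0%N).
  by rewrite multinomE (tnth_nth 0%N) nth_rcons size_tuple /= ltnn eqxx.
apply/mnmP => i; rewrite multinomE (tnth_nth 0%N) nth_rcons size_tuple /=.
case: ltnP => [lt_in | le_ni].
  have := mnm_nth 0%N [multinom m' (widen_ord (leqnSn n) i0) | i0 < n] (Ordinal lt_in).
  by rewrite mnmE /= => <-; congr (m' _); apply/val_inj.
have ei : i = ord_max.
  by apply/val_inj/eqP; rewrite /= eqn_leq le_ni -ltnS ltn_ord.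
by rewrite ei /= eqxx.
Qed.

Lemma coef_muni n (R : nzRingType) (p : {mpoly R[n.+1]}) j m :
  (muni p)`_j@_m = p@_[multinom of rcons m j].
Proof.
rewrite muniE coef_sum raddf_sum /= [in RHS](mpolyE p) raddf_sum /=.
apply: eq_bigr => m' _; rewrite coefZ coefXn !mcoeffZ mcoeffX multinom_eq_rcons.
by case: (j == _); rewrite ?(andbF, andbT) ?mulr1 ?mulr0 ?mcoeff0 ?mcoeffZ ?mcoeffX.
Qed.

(** The univariate case is applied to the last variable: all coefficients of
    the polynomial in that variable vanish at every point, hence are zero by
    induction. *)
Lemma mpoly_vanish (F : numDomainType) n (p : {mpoly F[n]}) :
  (forall v, p.@[v] = 0) -> p = 0.
Proof.
elim: n p => [|n IHn] p p0.
  move: (p0 (fun _ => 0)); rewrite [p]nvar0_mpolyC mevalC => ->.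
  by rewrite mpolyC0.
suff coef0 j : (muni p)`_j = 0.
  apply/mpolyP => m; rewrite mcoeff0.
  pose m1 := [multinom m (widen_ord (leqnSn n) i) | i < n].
  have /eqP -> : m == [multinom of rcons m1 (m ord_max)].
    by rewrite multinom_eq_rcons !eqxx.
  by rewrite -coef_muni coef0 mcoeff0.
apply: IHn => v.
have : map_poly (meval v) (muni p) = 0.
  apply: poly_vanish => x.
  (* [w] is the point [v] of the smaller space with last coordinate [x]. *)
  pose w (i : 'I_n.+1) := if insub (i : nat) is Some j then v (j : 'I_n) else x.
  rewrite -[RHS](p0 w) muniE mevalE.
  rewrite rmorph_sum horner_sum /=; apply: eq_bigr => m _.
  rewrite !map_polyZ /= map_polyXn !hornerE mevalZ mevalX big_ord_recr /=.
  rewrite {2}/w insubN ?ltnn // -!mulrA; congr (_ * (_ * _)).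
  apply: eq_bigr => i _; rewrite mnmE /w (insubT (fun i => i < n)%N (ltn_ord i)) /=.
  by congr (v _ ^+ _); apply/val_inj.
by move/polyP/(_ j); rewrite coef_map coef0.
Qed.

(** Divisibility is a local property: if [p] divided by its gcd with [q] had a
    root, then at that root [p] could not divide [q] even up to a factor
    invertible there. *)
Lemma locally_dvdp (F : closedFieldType) (p q : {poly F}) : p != 0 ->
  (forall t, root p t -> exists h u, h.[t] != 0 /\ h * q = u * p) -> p %| q.
Proof.
move=> nzp loc.
have nzd : gcdp p q != 0 by rewrite gcdp_eq0 negb_and nzp.
set d := gcdp p q in nzd.
have ep : p = p %/ d * d by rewrite divpK // dvdp_gcdl.
have eq : q = q %/ d * d by rewrite divpK // dvdp_gcdr.
have cop : coprimep (p %/ d) (q %/ d).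
  by apply: coprimep_div_gcd; rewrite nzp.
suff sz1 : size (p %/ d) == 1%N.
  move/size_poly1P: sz1 => [c nzc ec].
  by rewrite ep ec mul_polyC dvdpZl // dvdp_gcdr.
apply/closed_rootP => -[t rt].
have [|h [u [ht e]]] := loc t; first by rewrite ep rootM rt.
have : h * (q %/ d) = u * (p %/ d).
  by apply: (mulIf nzd); rewrite -!mulrA -ep -eq.
move/(congr1 (horner^~ t)); rewrite !hornerM (rootP rt) mulr0 => /eqP.
rewrite mulf_eq0 (negPf ht) /=; apply/negP.
by have := coprimep_root cop rt.
Qed.

Lemma dvdp_same_size (F : fieldType) (p q : {poly F}) k :
  size p = k -> (size q <= k)%N -> p %| q -> exists c, q = c *: p.
Proof.
move=> sp sq /dvdpP[r er].
have [r0 | nzr] := eqVneq r 0; first by exists 0; rewrite er r0 mul0r scale0r.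
have [p0 | nzp] := eqVneq p 0; first by exists 0; rewrite er p0 mulr0 scaler0.
exists r`_0; rewrite er -mul_polyC; congr (_ * _).
apply: size1_polyC; move: sq; rewrite er size_mul // -sp.
have : (0 < size p)%N by rewrite size_poly_gt0.
by case: (size p) => // n _; rewrite addnS /= -[X in (_ <= X)%N]add1n leq_add2r.
Qed.

Lemma size_affine (F : idomainType) (a b : F) :
  size (a%:P + b *: 'X : {poly F}) = if b == 0 then (a != 0) : nat else 2%N.
Proof.
have [->|nzb] := eqVneq b 0; first by rewrite scale0r addr0 size_polyC.
by rewrite addrC size_polyDl size_scale // size_polyX // size_polyC; case: (a == 0).
Qed.

Section Substitution.
Variables (n : nat) (C : comNzRingType) (a b : {mpoly C[n]}).
Let congr p q := exists u v, p - q = a * u + b * v.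

(** The congruence modulo the ideal of [a] and [b] is compatible with sums and
    products, so it spreads from the variables to all polynomials. *)
Lemma comp_mpoly_congr (l : n.-tuple {mpoly C[n]}) :
  (forall i, exists u v, 'X_i - tnth l i = a * u + b * v) ->
  forall p, exists u v, p - (p \mPo l) = a * u + b * v.
Proof.
move=> hl p.
have cD p1 q1 p2 q2 : congr p1 q1 -> congr p2 q2 -> congr (p1 + p2) (q1 + q2).
  move=> [u1 [v1 e1]] [u2 [v2 e2]]; exists (u1 + u2), (v1 + v2).
  by rewrite opprD addrACA e1 e2 !mulrDr addrACA.
have cM p1 q1 p2 q2 : congr p1 q1 -> congr p2 q2 -> congr (p1 * p2) (q1 * q2).
  move=> [u1 [v1 e1]] [u2 [v2 e2]].
  exists (u1 * p2 + q1 * u2), (v1 * p2 + q1 * v2).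
  have -> : p1 * p2 - q1 * q2 = (p1 - q1) * p2 + q1 * (p2 - q2).
    by rewrite mulrBl mulrBr addrA subrK.
  rewrite e1 e2 !mulrDl !mulrDr !mulrA addrACA; congr (_ + _ + (_ + _)).
    by rewrite (mulrC q1).
  by rewrite (mulrC q1).
have c0 q : congr q q by exists 0, 0; rewrite subrr !mulr0 addr0.
change (congr p (p \mPo l)).
rewrite comp_mpolyEX {1}(mpolyE p); apply: big_ind2 => // m _.
rewrite -!mul_mpolyC; apply: (cM) => //.
rewrite comp_mpolyX mpolyXE_id; apply: big_ind2 => // i _.
elim: (m i) => [|k IH]; first by rewrite !expr0.
by rewrite !exprS; apply: cM IH; apply: hl.
Qed.
End Substitution.

(** * Lines and points of the plane *)

Section Plane.
Variable R : realType.
Local Notation C := R[i].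
Implicit Types (P Q V : 'rV[C]_3) (F G l m : {mpoly C[3]}) (d : nat).

Lemma value_scale d F P c : F \is d.-homog -> value F (c *: P) = c ^+ d * value F P.
Proof.
move=> hF; rewrite /value !mevalE mulr_sumr big_seq [RHS]big_seq.
apply: eq_bigr => m /(dhomog_mf hF) /= mE; rewrite mulrCA; congr (_ * _).
rewrite -mE mdegE -prodrXr -big_split /=.
by apply: eq_bigr => i _; rewrite mxE exprMn.
Qed.

Lemma valueM F G P : value (F * G) P = value F P * value G P.
Proof. exact: mevalM. Qed.

Lemma valueB F G P : value (F - G) P = value F P - value G P.
Proof. exact: mevalB. Qed.

Lemma valueZ c F P : value (c *: F) P = c * value F P.
Proof. exact: mevalZ. Qed.

Lemma value_prod (I : finType) (S : {set I}) (f : I -> {mpoly C[3]}) P :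
  value (\prod_(i in S) f i) P = \prod_(i in S) value (f i) P.
Proof. exact: rmorph_prod. Qed.

Lemma same_curve_sym F G : same_curve F G -> same_curve G F.
Proof.
move=> [c nzc ->]; exists c^-1; first by rewrite invr_eq0.
by rewrite scalerA mulVf // scale1r.
Qed.

(** Through the column of coefficients, statements about lines and points
    become statements about ranks of matrices with three rows. *)
Definition coefs l : 'cV[C]_3 := \col_j l@_U_(j).

Lemma linearE l : l \is 1.-homog -> l = \sum_j coefs l j 0 *: 'X_j.
Proof.
move=> hl; apply/mpolyP => m; rewrite raddf_sum /=.
case: (boolP (mdeg m == 1%N)) => [/mdeg1P[j /eqP ->] | nm].
  rewrite (bigD1 j) //= big1 ?addr0 => [|i ne_ij].
    by rewrite mcoeffZ mcoeffX eqxx mulr1 mxE.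
  by rewrite mcoeffZ mcoeffX eq_mnm1 ?(negPf ne_ij) ?mulr0.
rewrite (dhomog_nemf_coeff hl nm) big1 // => i _.
rewrite mcoeffZ mcoeffX; case: eqP => [em|]; last by rewrite mulr0.
by rewrite -em mdeg1 eqxx in nm.
Qed.

Lemma value_linear l P : l \is 1.-homog -> value l P = (P *m coefs l) 0 0.
Proof.
move=> hl; rewrite {1}(linearE hl) /value raddf_sum mxE /=.
by apply: eq_bigr => j _; rewrite mevalZ mevalXU mulrC.
Qed.

Lemma coefs_inj l m : l \is 1.-homog -> m \is 1.-homog -> coefs l = coefs m -> l = m.
Proof. by move=> hl hm e; rewrite (linearE hl) e -(linearE hm). Qed.

Lemma coefsZ c l : coefs (c *: l) = c *: coefs l.
Proof. by apply/colP => j; rewrite !mxE mcoeffZ. Qed.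

Lemma coefsD l m : coefs (l + m) = coefs l + coefs m.
Proof. by apply/colP => j; rewrite !mxE mcoeffD. Qed.

Lemma coefs0 : coefs 0 = 0.
Proof. by apply/colP => j; rewrite !mxE mcoeff0. Qed.

Lemma value_lin_comb l P Q a b : l \is 1.-homog ->
  value l (a *: P + b *: Q) = a * value l P + b * value l Q.
Proof. by move=> hl; rewrite !value_linear // mulmxDl -!scalemxAl !mxE. Qed.

Lemma lies_onE l P : l \is 1.-homog -> lies_on P l = (P *m coefs l == 0).
Proof.
move=> hl; rewrite /lies_on value_linear //; apply/eqP/eqP => [e | ->]; last by rewrite mxE.
by apply/matrixP => i j; rewrite !ord1 e mxE.
Qed.

Lemma rank_distinct_lines l m : plane_curve 1 l -> plane_curve 1 m -> ~ same_curve l m ->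
  \rank (row_mx (coefs l) (coefs m)) = 2%N.
Proof.
move=> [hl nl] [hm nm] ne; rewrite -mxrank_tr tr_row_mx.
have nzl : (coefs l)^T != 0.
  apply: contraNneq nl => /(congr1 trmx); rewrite trmxK trmx0 -coefs0.
  by move/coefs_inj ->; rewrite ?rpred0.
have nzm : (coefs m)^T != 0.
  apply: contraNneq nm => /(congr1 trmx); rewrite trmxK trmx0 -coefs0.
  by move/coefs_inj ->; rewrite ?rpred0.
rewrite -addsmxE; have := mxrank_sum_cap (coefs l)^T (coefs m)^T.
rewrite !rank_rV nzl nzm.
suff -> : \rank ((coefs l)^T :&: (coefs m)^T) = 0%N by rewrite addn0.
apply/eqP; rewrite mxrank_eq0; apply/eqP/row_matrixP => i; rewrite row0.
set u := row i _; apply/eqP; apply: contraT => nzu.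
have : (u <= (coefs l)^T :&: (coefs m)^T)%MS by exact: row_sub.
rewrite sub_capmx => /andP[/sub_rVP[a ea] /sub_rVP[b eb]].
have nza : a != 0 by apply: contraNneq nzu => a0; rewrite ea a0 scale0r.
have nzb : b != 0 by apply: contraNneq nzu => b0; rewrite eb b0 scale0r.
case: ne; exists (b^-1 * a); first by rewrite mulf_neq0 ?invr_eq0.
apply: coefs_inj => //; first exact: rpredZ.
apply: trmx_inj; rewrite coefsZ linearZ /= -scalerA -ea eb scalerA mulVf //.
by rewrite scale1r.
Qed.

Lemma lies_on_row_mx l m P : l \is 1.-homog -> m \is 1.-homog ->
  (P <= kermx (row_mx (coefs l) (coefs m)))%MS = lies_on P l && lies_on P m.
Proof.
move=> hl hm; rewrite !lies_onE //; apply/sub_kermxP/andP; rewrite mul_mx_row.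
  by move/eqP; rewrite row_mx_eq0 => /andP.
by case=> /eqP -> /eqP ->; rewrite row_mx0.
Qed.

Lemma lines_meet_once l m P Q : plane_curve 1 l -> plane_curve 1 m -> ~ same_curve l m ->
  lies_on Q l -> lies_on Q m -> Q != 0 -> lies_on P l -> lies_on P m ->
  exists c, P = c *: Q.
Proof.
move=> cl cm ne Ql Qm nzQ Pl Pm.
have [hl _] := cl; have [hm _] := cm.
have rk := rank_distinct_lines cl cm ne.
apply/sub_rVP; set K := kermx (row_mx (coefs l) (coefs m)).
have QK : (Q <= K)%MS by rewrite lies_on_row_mx // Ql.
have PK : (P <= K)%MS by rewrite lies_on_row_mx // Pl.
apply: submx_trans PK _.
by rewrite -(mxrank_leqif_sup QK) rank_rV nzQ mxrank_ker rk.
Qed.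

Lemma point_off l m : plane_curve 1 l -> plane_curve 1 m -> ~ same_curve l m ->
  exists2 P, lies_on P l & ~~ lies_on P m.
Proof.
move=> cl cm ne.
have [hl _] := cl; have [hm _] := cm.
have rk := rank_distinct_lines cl cm ne.
set K := kermx (row_mx (coefs l) (coefs m)).
have : ~~ (kermx (coefs l) <= K)%MS.
  apply/negP => /mxrankS; rewrite !mxrank_ker rk.
  by case: (\rank _) (rank_leq_col (coefs l)) => [|[]].
case/row_subPn => i nK; exists (row i (kermx (coefs l))).
  by rewrite lies_onE // -row_mul mulmx_ker row0.
move: nK; rewrite lies_on_row_mx // lies_onE // -row_mul mulmx_ker row0 eqxx.
by [].
Qed.

(** The columns of coefficients of the lines through [P] form the plane
    orthogonal to [P], and two distinct lines already span it. *)
Lemma concurrent_pencil l m n P : plane_curve 1 l -> plane_curve 1 m -> ~ same_curve l m ->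
  n \is 1.-homog -> P != 0 -> lies_on P l -> lies_on P m -> lies_on P n ->
  exists a b, n = a *: l + b *: m.
Proof.
move=> cl cm ne hn nzP Pl Pm Pn.
have [hl _] := cl; have [hm _] := cm.
have rk := rank_distinct_lines cl cm ne.
set M := row_mx (coefs l) (coefs m) in rk *.
have [N eN] : exists N, coefs n = M *m N.
  suff /submxP[N e] : ((coefs n)^T <= M^T)%MS.
    by exists N^T; apply: trmx_inj; rewrite trmx_mul trmxK.
  have sP k (A : 'M_(3, k)) : P *m A = 0 -> (A^T <= kermx P^T)%MS.
    by move=> e; apply/sub_kermxP; rewrite -trmx_mul e trmx0.
  have sM : (M^T <= kermx P^T)%MS.
    by apply: sP; apply/sub_kermxP; rewrite lies_on_row_mx // Pl.
  have : (kermx P^T <= M^T)%MS.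
    by rewrite -(mxrank_leqif_sup sM) mxrank_ker !mxrank_tr rk rank_rV nzP.
  by apply: submx_trans; apply: sP; apply/eqP; rewrite -lies_onE.
exists (N (lshift 1 0) 0), (N (rshift 1 0) 0).
apply: coefs_inj => //; first by rewrite rpredD ?rpredZ.
apply/colP => j; rewrite eN coefsD !coefsZ !mxE big_split_ord !big_ord1 /=.
by rewrite row_mxEl row_mxEr !mxE mulrC [X in _ + X]mulrC.
Qed.

(** * Forms vanishing on a line *)

Definition vanishes_on l F := forall P, lies_on P l -> lies_on P F.

(** With [V] a point where [l] takes the value 1, the substitution of
    [X - l(X) V] for [X] is the linear projection onto the line [l = 0]. A
    polynomial vanishes on the line exactly when this substitution kills it; as
    the substitution is a ring morphism into a domain and is congruent to the
    identity modulo [l], the polynomials vanishing on the line form a prime ideal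
    generated by [l]. *)
Lemma line_projection l : plane_curve 1 l -> exists w : 3.-tuple {mpoly C[3]},
  (forall F, vanishes_on l F <-> F \mPo w = 0) /\
  (forall F, F \mPo w = 0 -> exists G, F = l * G).
Proof.
move=> [hl nl].
have [V lV] : exists V, value l V = 1.
  have [j nj] : exists j, coefs l j 0 != 0.
    apply/existsP; apply: contraNT nl; rewrite negb_exists => /forallP z.
    rewrite (linearE hl) big1 // => i _; move: (z i); rewrite negbK => /eqP ->.
    by rewrite scale0r.
  exists ((coefs l j 0)^-1 *: delta_mx 0 j).
  by rewrite value_linear // -scalemxAl -rowE mxE [row _ _ _ _]mxE mulVf.
have onl P : lies_on (P - value l P *: V) l.
  by rewrite /lies_on -{1}[P]scale1r -scaleNr value_lin_comb // lV mulr1 mul1r addrN.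
pose w := [tuple 'X_i - l * (V 0 i)%:MP | i < 3].
have cg i : exists u v, 'X_i - tnth w i = l * u + 0 * v.
  by exists ((V 0 i)%:MP), 0; rewrite tnth_mktuple opprB addrC subrK mul0r addr0.
have ev F P : value (F \mPo w) P = value F (P - value l P *: V).
  rewrite /value comp_mpoly_meval; apply: meval_eq => i.
  by rewrite tnth_mktuple mevalB mevalXU mevalM mevalC !mxE.
exists w; split=> // F.
  split=> [van | F0 P Pl].
    apply: mpoly_vanish => v; have := ev F (\row_i v i).
    rewrite (eqP (van _ (onl _))) /value => <-; apply: meval_eq => i.
    by rewrite mxE.
  have := ev F P; rewrite F0 (eqP Pl) scale0r subr0 => e.
  by rewrite /lies_on -e /value meval0.
move=> F0; have [u [v]] := comp_mpoly_congr cg F.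
by rewrite F0 subr0 mul0r addr0 => ->; exists u.
Qed.

Lemma vanishes_dvd l F : plane_curve 1 l -> vanishes_on l F -> exists G, F = l * G.
Proof. by move=> /line_projection[w [h1 h2]] /h1/h2. Qed.

Lemma vanishes_prime l F G : plane_curve 1 l ->
  vanishes_on l (F * G) -> vanishes_on l F \/ vanishes_on l G.
Proof.
move=> /line_projection[w [h1 _]] /h1; rewrite rmorphM => /eqP.
by rewrite mulf_eq0 => /orP[] /eqP /h1; [left | right].
Qed.

(** Comparing the parts of degree [d] of the two sides; in degree 0 the right
    side has no such part. *)
Lemma homog_quotient d l F G : l \is 1.-homog -> F \is d.-homog -> F = l * G ->
  F = if d is e.+1 then l * pihomog mdeg e G else 0.
Proof.
move=> hl hF eF; rewrite -{1}(pihomog_dE hF) {1}eF.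
rewrite {1}(@pihomog_partitionE _ _ mdeg (msize G) G) //.
rewrite mulr_sumr raddf_sum /=.
have hi (i : nat) : l * pihomog mdeg i G \is i.+1.-homog.
  by rewrite -[i.+1]add1n; apply: dhomogM hl _; apply: pihomogP.
case: d hF => [|d] hF.
  by rewrite big1 // => i _; apply: (pihomog_ne0 _ (hi i)).
case: (ltnP d (msize G)) => [lt_d | le_d].
  rewrite (bigD1 (Ordinal lt_d)) //= (pihomog_dE (hi d)) big1 ?addr0 // => i ne.
  by apply: (pihomog_ne0 _ (hi i)); rewrite eqSS.
rewrite big1 => [|i _].
  rewrite pihomogE big_seq_cond big_pred0 ?mulr0 // => m.
  apply/negP => /andP[/msize_mdeg_lt lt /eqP em].
  by move: lt; rewrite em ltnNge le_d.
apply: (pihomog_ne0 _ (hi i)); rewrite eqSS.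
by rewrite neq_ltn (leq_trans (ltn_ord i) le_d).
Qed.

Lemma line_factor d l F : plane_curve 1 l -> F \is d.-homog -> vanishes_on l F ->
  exists2 G, F = l * G & if d is e.+1 then G \is e.-homog else G = 0.
Proof.
move=> cl hF /(vanishes_dvd cl)[G /(homog_quotient cl.1 hF)].
case: d hF => [|e] hF -> ; last by exists (pihomog mdeg e G); rewrite ?pihomogP.
by exists 0; rewrite ?mulr0.
Qed.

(** Substituting [(g(X) / g(P)) P] for [X] moves every point off the green line
    to [P], so it kills a form that vanishes at [P]. The difference between [X] and
    its image has linear coordinates vanishing at [P], hence lying in the ideal
    of [l] and [m]. *)
Lemma vanishing_at_meet g l m P F d : plane_curve 1 g -> plane_curve 1 l -> plane_curve 1 m ->
  ~ same_curve l m -> lies_on P l -> lies_on P m -> ~~ lies_on P g -> P != 0 ->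
  F \is d.-homog -> lies_on P F -> exists u v, F = l * u + m * v.
Proof.
move=> [hg _] cl cm ne Pl Pm Pg nzP hF PF.
pose w := [tuple ((P 0 i / value g P) *: g : {mpoly C[3]}) | i < 3].
have F0 : F \mPo w = 0.
  apply: mpoly_vanish => v; rewrite comp_mpoly_meval.
  transitivity (value F ((g.@[v] / value g P) *: P)).
    by apply: meval_eq => i; rewrite tnth_mktuple mevalZ !mxE; ring.
  by rewrite (value_scale _ _ hF) (eqP PF) mulr0.
have [|u [v]] := @comp_mpoly_congr _ _ l m w _ F; last first.
  by rewrite F0 subr0 => ->; exists u, v.
move=> i; rewrite tnth_mktuple.
have [||a [b ->]] := concurrent_pencil cl cm ne (n := 'X_i - (P 0 i / value g P) *: g) _ nzP Pl Pm.
- by rewrite rpredB ?rpredZ // dhomogX /= mdeg1.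
- by rewrite /lies_on valueB valueZ divfK // /value mevalXU subrr.
by exists a%:MP, b%:MP; rewrite ![_ * _%:MP]mulrC !mul_mpolyC.
Qed.

(** * Restriction to a line *)

(** The polynomial [F(V + X Q)]. With [Q] on the green line, that point is at
    infinity in this parametrization: this lowers the degree of the restriction
    of a form vanishing at [Q], and leaves the affine part of the line, where all
    the crossings are. *)
Definition line_restr V Q F : {poly C} :=
  mmap (@polyC C) (fun i => (V 0 i)%:P + Q 0 i *: 'X) F.

Lemma line_restrD V Q F G : line_restr V Q (F + G) = line_restr V Q F + line_restr V Q G.
Proof. exact: raddfD. Qed.

Lemma line_restrM V Q F G : line_restr V Q (F * G) = line_restr V Q F * line_restr V Q G.
Proof. exact: rmorphM. Qed.

Lemma line_restr_prod V Q (I : finType) (S : {set I}) (f : I -> {mpoly C[3]}) :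
  line_restr V Q (\prod_(i in S) f i) = \prod_(i in S) line_restr V Q (f i).
Proof. exact: rmorph_prod. Qed.

Lemma horner_line_restr V Q F t : (line_restr V Q F).[t] = value F (V + t *: Q).
Proof.
rewrite /line_restr /mmap /value mevalE horner_sum; apply: eq_bigr => m _.
rewrite hornerM hornerC horner_prod; congr (_ * _); apply: eq_bigr => i _.
by rewrite horner_exp !hornerE !mxE mulrC.
Qed.

Lemma size_line_restr d V Q F : F \is d.-homog -> (size (line_restr V Q F) <= d.+1)%N.
Proof.
move=> hF; rewrite /line_restr /mmap big_seq.
apply: (leq_trans (size_sum _ _ _)); apply/bigmax_leqP_seq => m mF _.
rewrite mul_polyC; apply: (leq_trans (size_scale_leq _ _)).
rewrite -(dhomog_mf hF mF) /= mdegE /mmap1.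
apply: (@big_ind2 _ _ (fun (p : {poly C}) e => (size p <= e.+1)%N)) => [|p1 e1 p2 e2 h1 h2|i _].
- by rewrite size_poly1.
- apply: (leq_trans (size_polyMleq _ _)); rewrite -subn1 leq_subLR add1n.
  by rewrite (leq_trans (leq_add h1 h2)) // addSn addnS.
apply: (leq_trans (size_poly_exp_leq _ _)); rewrite ltnS -[X in (_ <= X)%N]mul1n leq_mul2r.
apply/orP; right; rewrite -subn1 leq_subLR.
rewrite (leq_trans (size_polyD _ _)) // geq_max (leq_trans (size_polyC_leq1 _)) //=.
by rewrite (leq_trans (size_scale_leq _ _)) // size_polyX.
Qed.

(** Choices of [V] and [Q] for which [line_restr V Q] parametrizes the part of
    [l] off [g]. *)
Definition line_frame g l V Q :=
  [/\ lies_on V l, ~~ lies_on V g, lies_on Q l, lies_on Q g & Q != 0].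

Section Frame.
Variables (g l : {mpoly C[3]}) (V Q : 'rV[C]_3).
Hypotheses (cg : plane_curve 1 g) (cl : plane_curve 1 l) (fr : line_frame g l V Q).

Lemma frame_distinct : ~ same_curve l g.
Proof.
by case: fr => Vl Vg _ _ _ [c _ e]; move: Vg; rewrite /lies_on e valueZ (eqP Vl) mulr0 eqxx.
Qed.

Lemma frame_on_line t : lies_on (V + t *: Q) l.
Proof.
case: fr => Vl Vg Ql Qg _.
by rewrite /lies_on -[V]scale1r value_lin_comb ?cl.1 // (eqP Vl) (eqP Ql) !mulr0 addr0.
Qed.

Lemma frame_off_green t : value g (V + t *: Q) = value g V.
Proof.
case: fr => Vl Vg Ql Qg _.
by rewrite -[V]scale1r value_lin_comb ?cg.1 // (eqP Qg) scale1r mulr0 mul1r addr0.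
Qed.

Lemma vanishes_line_restr F : vanishes_on l F -> line_restr V Q F = 0.
Proof.
by move=> van; apply: poly_vanish => t; rewrite horner_line_restr (eqP (van _ (frame_on_line t))).
Qed.

(** Homogeneity carries the zeros of [F] from the points [V + t Q] to all points
    of [l] off [g]. Thus [g * F] vanishes on [l], and [l] is prime. *)
Lemma line_restr_vanishes d F : F \is d.-homog -> line_restr V Q F = 0 -> vanishes_on l F.
Proof.
move=> hF F0; have [Vl Vg Ql Qg nzQ] := fr.
have [//|] : vanishes_on l g \/ vanishes_on l F; last by [].
  apply: (vanishes_prime cl) => P Pl; rewrite /lies_on valueM.
  have [gP | gP] := eqVneq (value g P) 0; first by rewrite gP mul0r.
  pose s := value g P / value g V.
  have nzs : s != 0 by rewrite mulf_neq0 ?invr_eq0.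
  have [c ec] : exists c, P - s *: V = c *: Q.
    apply: (lines_meet_once cl cg frame_distinct Ql Qg nzQ).
      by rewrite /lies_on -{1}[P]scale1r -scaleNr value_lin_comb ?cl.1 // (eqP Pl) (eqP Vl) !mulr0 addr0.
    rewrite /lies_on -{1}[P]scale1r -scaleNr value_lin_comb ?cg.1 //.
    by rewrite mul1r mulNr /s divfK // subrr.
  have -> : P = s *: (V + (c / s) *: Q).
    by rewrite scalerDr scalerA mulrCA divff // mulr1 -ec addrC subrK.
  by rewrite (value_scale _ _ hF) -horner_line_restr F0 horner0 !mulr0.
by move=> van; move: (van V Vl); rewrite (negPf Vg).
Qed.

End Frame.

(** * Local ideals at the crossings *)

Lemma in_local_ideal_comb P A B F G c :
  in_local_ideal P A B F -> in_local_ideal P A B G -> in_local_ideal P A B (F - c *: G).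
Proof.
move=> [H1 [U1 [V1 [n1 e1]]]] [H2 [U2 [V2 [n2 e2]]]].
exists (H1 * H2), (H2 * U1 - c *: (H1 * U2)), (H2 * V1 - c *: (H1 * V2)); split.
  by rewrite /lies_on valueM mulf_eq0 negb_or n1.
rewrite -!mul_mpolyC.
have -> : H1 * H2 * (F - c%:MP * G) = H2 * (H1 * F) - c%:MP * (H1 * (H2 * G)) by ring.
by rewrite e1 e2; ring.
Qed.

(** In [H l G = U l A + V B] the term [V B] is divisible by the prime [l], and
    [B] is not, so [l] can be cancelled throughout. *)
Lemma in_local_ideal_peel P l A B G : plane_curve 1 l -> ~ vanishes_on l B ->
  in_local_ideal P (l * A) B (l * G) -> in_local_ideal P A B G.
Proof.
move=> cl nB [H [U [V [nH e]]]].
have [W eV] : exists W, V = l * W.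
  apply: (vanishes_dvd cl).
  have [//|/nB//] : vanishes_on l V \/ vanishes_on l B.
  apply: (vanishes_prime cl) => Z Zl; rewrite /lies_on.
  have -> : V * B = l * (H * G - U * A).
    by rewrite mulrBr mulrCA e addrC [l * (U * A)]mulrCA addKr.
  by rewrite valueM (eqP Zl) mul0r.
exists H, U, W; split=> //; apply: (mulfI cl.2).
by rewrite mulrCA e eV mulrDr mulrCA !mulrA.
Qed.

End Plane.

Section Lines.
Variables (R : realType) (k : nat).
Local Notation C := R[i].
Variables (g : {mpoly C[3]}) (L : 'I_(2 * k) -> {mpoly C[3]}) (red : {set 'I_(2 * k)}).
Hypotheses (cg : plane_curve 1 g) (cL : forall i, plane_curve 1 (L i)).
Local Notation A := (\prod_(a in red) L a).
Local Notation B := (\prod_(b in ~: red) L b).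

Lemma homog_prod_lines (S : {set 'I_(2 * k)}) : \prod_(i in S) L i \is #|S|.-homog.
Proof.
rewrite -sum1_card; apply: (@big_ind2 _ _ (fun (p : {mpoly C[3]}) d => p \is d.-homog)).
- exact: dhomog1.
- by move=> *; apply: dhomogM.
by move=> i _; case: (cL i).
Qed.

(** On the red line [L i] the product of the red lines vanishes, so each local
    condition says that [B] divides [G] near that point of the line. *)
Lemma line_restr_local_dvd (S : {set 'I_(2 * k)}) i V Q G :
  S \subset red -> i \in S -> line_frame g (L i) V Q -> line_restr V Q B != 0 ->
  (forall P j, crossing g L red P i j -> in_local_ideal P (\prod_(a in S) L a) B G) ->
  line_restr V Q B %| line_restr V Q G.
Proof.
move=> sS iS fr nzB loc; apply: locally_dvdp => // t; rewrite rootE.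
have [Vl Vg Ql Qg nzQ] := fr.
rewrite line_restr_prod horner_prod prodf_seq_eq0 => /hasP[j _ /andP[jb]].
rewrite horner_line_restr => Pj.
have Pg : ~~ lies_on (V + t *: Q) g by rewrite /lies_on (frame_off_green cg fr).
have [|H [U [W [nH e]]]] := loc (V + t *: Q) j.
  split=> //; last by split=> //; apply: (frame_on_line (cL i) fr).
  - apply: contraNneq Pg => ->; rewrite /lies_on value_linear ?cg.1 //.
    by rewrite mul0mx mxE.
  - exact: (subsetP sS).
  - by rewrite inE in jb.
exists (line_restr V Q H), (line_restr V Q W); split; first by rewrite horner_line_restr.
rewrite -line_restr_prod -!line_restrM e line_restrD -[RHS]add0r; congr (_ + _).
apply: (vanishes_line_restr (cL i) fr) => P Pi.
by rewrite /lies_on valueM value_prod (bigD1 i) //= (eqP Pi) mul0r mulr0.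
Qed.

(** The point of a red line on the green line lies on exactly one of the [k] blue
    lines. Sending it to infinity leaves the restriction of [B] with degree
    [k - 1]; this is the only trace of the triple points in the argument for
    uniqueness. *)
Hypothesis frames : forall i, i \in red ->
  exists V Q, line_frame g (L i) V Q /\ size (line_restr V Q B) = k.

Lemma blue_not_on_red i : (0 < k)%N -> i \in red -> ~ vanishes_on (L i) B.
Proof.
move=> k0 /frames[V [Q [fr sz]]] /(vanishes_line_restr (cL i) fr) e.
by move: k0; rewrite -sz e size_poly0.
Qed.

Lemma peel_red_line (S : {set 'I_(2 * k)}) i G P : (0 < k)%N -> S \subset red -> i \in S ->
  in_local_ideal P (\prod_(a in S) L a) B (L i * G) ->
  in_local_ideal P (\prod_(a in S :\ i) L a) B G.
Proof.
move=> k0 sS iS; rewrite (big_setD1 i iS) /=.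
by apply: in_local_ideal_peel => //; apply: blue_not_on_red => //; apply: (subsetP sS).
Qed.

(** The restriction of [G] to the red line is a multiple of that of [B], whose
    degree [k - 1] exceeds [d]; hence it is zero. *)
Lemma red_line_factor d (S : {set 'I_(2 * k)}) i G :
  S \subset red -> i \in S -> (d.+1 < k)%N -> G \is d.-homog ->
  (forall P j, crossing g L red P i j ->
     in_local_ideal P (\prod_(a in S) L a) B G) ->
  exists2 G1, G = L i * G1 & if d is e.+1 then G1 \is e.-homog else G1 = 0.
Proof.
move=> sS iS dk hG loc.
have [V [Q [fr sz]]] := frames (subsetP sS i iS).
have nzB : line_restr V Q B != 0 by rewrite -size_poly_gt0 sz (leq_trans _ dk).
apply: (line_factor (cL i) hG); apply: (line_restr_vanishes cg (cL i) fr hG).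
have := line_restr_local_dvd sS iS fr nzB loc.
apply: contraTeq => nzG; apply/negP => /(dvdp_leq nzG).
by rewrite sz leqNgt (leq_ltn_trans (size_line_restr V Q hG) dk).
Qed.

(** The red lines are split off one after another. Each step lowers the degree
    of the form and the number of red lines by one, so the degree runs out
    first. *)
Lemma low_degree_vanishes d (S : {set 'I_(2 * k)}) G :
  S \subset red -> (d < #|S|)%N -> (d.+1 < k)%N -> G \is d.-homog ->
  (forall P i j, i \in S -> crossing g L red P i j ->
     in_local_ideal P (\prod_(a in S) L a) B G) -> G = 0.
Proof.
elim: d S G => [|d IHd] S G sS dS dk hG loc;
  (have [i iS] : exists i, i \in S by apply/card_gt0P/(leq_trans _ dS));
  have [G1 eG hG1] := red_line_factor sS iS dk hG (fun P j => loc P i j iS).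
  by rewrite eG hG1 mulr0.
rewrite eG (IHd (S :\ i) G1) ?mulr0 //.
- exact: subset_trans (subsetDl _ _) sS.
- by move: dS; rewrite (cardsD1 i) iS.
- exact: ltnW.
move=> P i' j; rewrite in_setD1 => /andP[_ i'S] cr.
by apply: peel_red_line => //; rewrite -?eG; [apply: leq_trans dk | apply: loc cr].
Qed.

(** On one red line, the restrictions of [F] and [G] are scalar multiples of that
    of [B], which already has degree [k - 1]. Some difference [G - c F] hence
    vanishes on that line; splitting it off leaves degree [k - 2], and
    [low_degree_vanishes] applies. *)
Lemma curve_through_mult_unique F G : (0 < k)%N -> #|red| = k -> F != 0 ->
  F \is (k - 1).-homog -> G \is (k - 1).-homog ->
  through_crossings_mult g L red F -> through_crossings_mult g L red G ->
  exists c, G = c *: F.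
Proof.
move=> k0 cr nzF hF hG tF tG.
have [i ir] : exists i, i \in red by apply/card_gt0P; rewrite cr.
have [V [Q [fr sz]]] := frames ir.
have nzB : line_restr V Q B != 0 by rewrite -size_poly_gt0 sz.
have multB H : H \is (k - 1).-homog -> through_crossings_mult g L red H ->
    exists c, line_restr V Q H = c *: line_restr V Q B.
  move=> hH tH; apply: (dvdp_same_size sz).
    by apply: leq_trans (size_line_restr V Q hH) _; rewrite subn1 prednK.
  by apply: (line_restr_local_dvd (subxx red) ir fr nzB) => P j /tH.
have key H : H \is (k - 1).-homog -> through_crossings_mult g L red H ->
    line_restr V Q H = 0 -> H = 0.
  move=> hH tH H0.
  have [H1 eH hH1] := line_factor (cL i) hH (line_restr_vanishes cg (cL i) fr hH H0).
  rewrite eH; case ek : (k - 1)%N hH1 => [|d] hH1; first by rewrite hH1 mulr0.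
  have ck : #|red :\ i| = d.+1.
    by apply: succn_inj; rewrite -ek subn1 prednK // -[RHS]cr (cardsD1 i red) ir.
  rewrite (low_degree_vanishes (S := red :\ i) (d := d) (G := H1)) ?mulr0 ?ck //.
  - exact: subsetDl.
  - by rewrite -ek subn1 prednK.
  move=> P i' j _ cr'; apply: peel_red_line => //.
  by rewrite -eH; apply: tH cr'.
have [a ea] := multB F hF tF.
have [b eb] := multB G hG tG.
have nza : a != 0.
  by apply: contraNneq nzF => a0; apply/eqP; apply: key => //; rewrite ea a0 scale0r.
exists (b / a); apply/eqP; rewrite -subr_eq0; apply/eqP/key.
- by rewrite rpredB ?rpredZ.
- by move=> P i' j cr'; apply: in_local_ideal_comb; [apply: tG cr' | apply: tF cr'].
rewrite -scaleNr line_restrD -mul_mpolyC line_restrM.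
have -> : line_restr V Q (- (b / a))%:MP = (- (b / a))%:P by rewrite /line_restr mmapC.
by rewrite ea eb mul_polyC scalerA mulNr divfK // scaleNr subrr.
Qed.

(** Off the green line [g] is invertible, so the identity itself exhibits the
    local membership. If [F] were zero, [B] would vanish on the red lines. *)
Lemma green_combination c F : (0 < k)%N -> c != 0 -> #|red| = k ->
  A - c *: B = g * F -> F != 0 /\ through_crossings_mult g L red F.
Proof.
move=> k0 nzc cr e; split; last first.
  move=> P i j [_ Pg _ _ _]; exists g, 1, (- c%:MP); split=> //.
  by rewrite -e mul1r mulNr mul_mpolyC.
apply: contraPneq e => ->; rewrite mulr0 => /eqP; rewrite subr_eq0 => /eqP e.
have [i ir] : exists i, i \in red by apply/card_gt0P; rewrite cr.
have nB := blue_not_on_red k0 ir.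
case: nB => P Pi; have := congr1 (fun F => value F P) e.
rewrite /lies_on valueZ value_prod (bigD1 i) //= (eqP Pi) mul0r => /esym/eqP.
by rewrite mulf_eq0 (negPf nzc).
Qed.

End Lines.

(** * The configuration of triple points *)

Section Configuration.
Variables (R : realType) (k : nat).
Local Notation C := R[i].
Variables (g : {mpoly C[3]}) (L : 'I_(2 * k) -> {mpoly C[3]}) (red : {set 'I_(2 * k)}).
Variable p : 'I_k -> 'rV[C]_3.
Hypothesis conf : triple_point_configuration g L red p.

Let cg : plane_curve 1 g. Proof. by case: conf. Qed.
Let cL i : plane_curve 1 (L i). Proof. by case: conf. Qed.

Lemma line_frame_at i t : lies_on (p t) (L i) -> exists V, line_frame g (L i) V (p t).
Proof.
case: conf => _ _ _ gd nzp _ pg _ _ _ Pi.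
have [V Vl Vg] : exists2 V, lies_on V (L i) & ~~ lies_on V g.
  by apply: point_off => // /same_curve_sym /gd.
by exists V; split.
Qed.

Lemma triple_point_unique i s t : lies_on (p s) (L i) -> lies_on (p t) (L i) -> s = t.
Proof.
case: conf => _ _ _ gd nzp dp pg _ _ _ Ps Pt; apply: dp.
have [c e] := lines_meet_once cg (cL i) (gd i) (pg s) Ps (nzp s) (pg t) Pt.
exists c => //; apply: contraNneq (nzp t) => c0.
by rewrite e c0 scale0r.
Qed.

(** The [k] triple points have distinct red lines and distinct blue lines, which
    already makes up all [2 * k] lines. *)
Lemma colored_pairs : exists r b : 'I_k -> 'I_(2 * k),
  [/\ injective r, injective b, red = r @: setT, ~: red = b @: setT &
    forall t, lies_on (p t) (L (r t)) /\ lies_on (p t) (L (b t))].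
Proof.
have [r hr] : exists r : 'I_k -> 'I_(2 * k), forall t, r t \in red /\ lies_on (p t) (L (r t)).
  apply: (fin_all_exists (P := fun t i => i \in red /\ lies_on (p t) (L i))) => t.
  by have [i ir] := points_red conf t; rewrite inE; exists i.
have [b hb] : exists b : 'I_k -> 'I_(2 * k), forall t, b t \in ~: red /\ lies_on (p t) (L (b t)).
  apply: (fin_all_exists (P := fun t i => i \in ~: red /\ lies_on (p t) (L i))) => t.
  by have [i ir] := points_blue conf t; rewrite inE; exists i; rewrite inE.
have ir : injective r.
  by move=> s t e; apply: (@triple_point_unique (r s)); [case: (hr s) | rewrite e; case: (hr t)].
have ib : injective b.
  by move=> s t e; apply: (@triple_point_unique (b s)); [case: (hb s) | rewrite e; case: (hb t)].
have cr : #|r @: setT| = k by rewrite card_imset // cardsT card_ord.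
have cb : #|b @: setT| = k by rewrite card_imset // cardsT card_ord.
have sr : r @: setT \subset red by apply/subsetP => _ /imsetP[t _ ->]; case: (hr t).
have sb : b @: setT \subset ~: red by apply/subsetP => _ /imsetP[t _ ->]; case: (hb t).
have lr := subset_leq_card sr; have lb := subset_leq_card sb.
have tot : (#|red| + #|~: red| = k + k)%N by rewrite cardsC card_ord mul2n addnn.
rewrite cr in lr; rewrite cb in lb.
exists r, b; split=> //.
- apply/esym/eqP; rewrite eqEcard sr cr /= -(leq_add2r k) -tot leq_add2l //.
- apply/esym/eqP; rewrite eqEcard sb cb /= -(leq_add2l k) -tot leq_add2r //.
by move=> t; split; [case: (hr t) | case: (hb t)].
Qed.

Lemma card_red : #|red| = k.
Proof. by have [r [b [ir _ -> _ _]]] := colored_pairs; rewrite card_imset // cardsT card_ord. Qed.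

(** The blue line through the triple point of a red line restricts to a nonzero
    constant, and each of the other [k - 1] blue lines to a polynomial of
    degree 1. *)
Lemma red_frames i : i \in red -> exists V Q,
  line_frame g (L i) V Q /\ size (line_restr V Q (\prod_(b in ~: red) L b)) = k.
Proof.
have [r [b [ir ib er eb on]]] := colored_pairs.
move=> ired; have /imsetP[t _ ei] : i \in r @: setT by rewrite -er.
have [V fr] := line_frame_at (proj1 (on t)); rewrite -ei in fr.
exists V, (p t); split=> //.
have lineE l : l \is 1.-homog -> line_restr V (p t) l = (value l V)%:P + value l (p t) *: 'X.
  move=> hl; apply/eqP; rewrite -subr_eq0; apply/eqP/poly_vanish => x.
  rewrite !hornerE horner_line_restr -[V]scale1r value_lin_comb // mul1r scale1r.
  by rewrite [x * _]mulrC subrr.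
have sz s : size (line_restr V (p t) (L (b s))) = if s == t then 1%N else 2%N.
  rewrite lineE ?(cL _).1 // size_affine.
  have [-> | ne_st] := eqVneq s t.
    rewrite (eqP (proj2 (on t))) eqxx; case: eqP => // /eqP Vb.
    have [Vl Vg Ql _ _] := fr.
    have [|c e] := lines_meet_once (P := V) (cL i) (cL (b t)) _ Ql (proj2 (on t)) (points_nonzero conf t) Vl Vb.
      move=> /(lines_distinct conf) e; move: ired; rewrite e; apply/negP.
      by rewrite -in_setC eb imset_f.
    have hg := cg.1.
    by move: Vg; rewrite /lies_on e (value_scale _ _ hg) (eqP (points_green conf t)) mulr0 eqxx.
  case: ifP => // Pb.
  by case/eqP: ne_st; apply: (@triple_point_unique (b s)); [case: (on s) |].
rewrite line_restr_prod eb big_imset /=; last by move=> ? ? _ _; apply: ib.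
rewrite (eq_bigl predT) => [|s]; last by rewrite inE.
rewrite size_prod => [|s _]; last by rewrite -size_poly_gt0 sz; case: ifP.
rewrite (eq_bigr _ (fun s _ => sz s)) (bigD1 t) //= eqxx.
rewrite (eq_bigr (fun _ => 2%N)) => [|s /negPf ->] //.
rewrite sum_nat_const (@eq_card _ _ (predC1 t)) => [|s]; last by rewrite !inE.
rewrite cardC1 !card_ord; have : (0 < k)%N by apply: leq_ltn_trans (ltn_ord t).
case: (k) => // n _.
by rewrite /= muln2 -addnn add1n -addnS -addSn addnK.
Qed.

(** At each triple point the red line is a combination of the blue line and
    [g]. Multiplying these relations shows that on the green line the products of
    the red and of the blue lines are proportional. *)
Lemma green_pencil : exists c F, [/\ c != 0, F \is (k - 1).-homog &
  \prod_(a in red) L a - c *: \prod_(b in ~: red) L b = g * F].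
Proof.
have [r [b [ir ib er eb on]]] := colored_pairs.
have comb t : exists c, c != 0 /\ exists d, L (r t) = c *: L (b t) + d *: g.
  have [Pr Pb] := on t.
  have [|c [d e]] := concurrent_pencil (cL (b t)) cg _ (cL (r t)).1 (points_nonzero conf t) Pb (points_green conf t) Pr.
    by move/same_curve_sym; apply: (green_distinct conf).
  exists c; split; last by exists d.
  apply/eqP => c0; rewrite c0 scale0r add0r in e.
  apply: (green_distinct conf (i := r t)); exists d => //.
  by apply: contraNneq (cL (r t)).2 => d0; rewrite e d0 scale0r.
have [c hc] := fin_all_exists comb.
pose A := \prod_(a in red) L a; pose B := \prod_(b in ~: red) L b.
have hA : A \is k.-homog.
  by have := homog_prod_lines cL red; rewrite card_red.
have hB : B \is k.-homog.
  have := homog_prod_lines cL (~: red).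
  by rewrite eb card_imset // cardsT card_ord -eb.
pose c0 := \prod_(t : 'I_k) c t.
have nzc0 : c0 != 0 by apply/prodf_neq0 => t _; case: (hc t).
have van : vanishes_on g (A - c0 *: B).
  move=> P Pg; rewrite /lies_on valueB valueZ !value_prod er big_imset /=; last exact: in2W.
  rewrite -er eb big_imset /=; last exact: in2W.
  rewrite (eq_bigl predT) => [|t]; last by rewrite inE.
  rewrite [X in _ - _ * X](eq_bigl predT) => [|t]; last by rewrite inE.
  rewrite (eq_bigr (fun t => c t * value (L (b t)) P)) => [|t _]; last first.
    have [_ [d ->]] := hc t.
    by rewrite /value mevalD !mevalZ -/(value g P) (eqP Pg) mulr0 addr0.
  by rewrite big_split subrr.
have hAB : A - c0 *: B \is k.-homog by rewrite rpredB ?rpredZ.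
have [F eF hF] := line_factor cg hAB van.
exists c0, F; split=> //.
case: (k) hF => [|n]; last by rewrite subn1.
by move=> ->; apply: rpred0.
Qed.

End Configuration.

(** At a crossing, every line other than its red and its blue one is
    invertible. The products of the red and of the blue lines thus generate there
    the same local ideal as these two transverse lines, the maximal ideal. *)
Lemma distinct_through_mult (R : realType) k (g : {mpoly R[i][3]})
    (L : 'I_(2 * k) -> {mpoly R[i][3]}) (red : {set 'I_(2 * k)}) d F :
  plane_curve 1 g -> (forall i, plane_curve 1 (L i)) ->
  (forall i j, same_curve (L i) (L j) -> i = j) ->
  distinct_crossings g L red -> F \is d.-homog ->
  through_crossings g L red F -> through_crossings_mult g L red F.
Proof.
move=> cg cL dL dc hF tF P i j cr.
have [nzP Pg ir jb [Pi Pj]] := cr.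
have ne : ~ same_curve (L i) (L j) by move=> /dL e; rewrite -e ir in jb.
have [u [v eF]] := vanishing_at_meet cg (cL i) (cL j) ne Pi Pj Pg nzP hF (tF P i j cr).
have jb' : j \in ~: red by rewrite inE.
rewrite (big_setD1 i ir) (big_setD1 j jb') /=.
set A := \prod_(a in red :\ i) L a; set B := \prod_(b in ~: red :\ j) L b.
exists (A * B), (u * B), (v * A); split; last by rewrite eF; ring.
rewrite /lies_on valueM !value_prod mulf_neq0 //; apply/prodf_neq0 => a.
  rewrite in_setD1 => /andP[nai ar]; apply: contra nai => Pa.
  by have [|-> _] := dc P a j i j _ cr.
rewrite !inE => /andP[naj ab]; apply: contra naj => Pa.
by have [|_ ->] := dc P i a i j _ cr.
Qed.

Theorem theorem4 (R : realType) (k : nat) (hk : (1 <= k)%N)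
    (g : {mpoly (R[i])[3]}) (L : 'I_(2 * k) -> {mpoly (R[i])[3]})
    (red : {set 'I_(2 * k)}) (p : 'I_k -> 'rV[R[i]]_3)
    (hconf : triple_point_configuration g L red p) :
  unique_curve (k - 1) (through_crossings_mult g L red) /\
  (distinct_crossings g L red ->
   unique_curve (k - 1) (through_crossings g L red)).
Proof.
have cg := green_line hconf; have cL := other_lines hconf.
have frames := red_frames hconf; have cr := card_red hconf.
have [c [F [nzc hF eF]]] := green_pencil hconf.
have [nzF tF] := green_combination cL frames hk nzc cr eF.
have uniq G : plane_curve (k - 1) G -> through_crossings_mult g L red G -> same_curve F G.
  move=> [hG nzG] tG.
  have [a ea] := curve_through_mult_unique cg cL frames hk cr nzF hF hG tF tG.
  by exists a => //; apply: contraNneq nzG => a0; rewrite ea a0 scale0r.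
split; first by exists F; split.
move=> dc; exists F; split=> // [|G cG tG]; first exact: through_crossings_multW.
by apply: uniq => //; apply: distinct_through_mult dc cG.1 tG => //; apply: lines_distinct hconf.
Qed.
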